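(* Fix an integer $k\ge 3$. Let $\mathcal H$ be a finite nonempty clutter, set $T=V(\mathcal H):=\bigcup_{e\in E(\mathcal H)}e$, and let $M\ge 1$ be an integer. There is a $2$-connected graph $G=G(k,\mathcal H,M)$ containing $T$ as an independent set such that the following hold. (i) $G$ is $2$-connected, $\chi(G)=k+1$, $\omega(G)=k$, and $|E(G)|\le k|V(G)|$. (ii) For every $X\subseteq V(G)$, if $X\cap T$ contains no edge of $\mathcal H$ (as a subset), then the induced subgraph $G[X]$ is $k$-colourable. (iii) For every $e\in E(\mathcal H)$ there are $M$ distinct $k$-bad odd cycles $C_{e,1},\dots,C_{e,M}$ of $G$ with $\operatorname{tr}_T(C_{e,j})=e$ for each $j$. The sets $V(C_{e,j})\setminus T$, over all pairs $(e,j)$ with $e\in E(\mathcal H)$ and $1\le j\le M$, are pairwise disjoint. Consequently, $E(\mathcal H)$ is exactly the set of inclusion-minimal members of $\operatorname{tr}_T(\mathcal C_k(G))=\{\operatorname{tr}_T(C):C\in\mathcal C_k(G)\}$. Moreover, $$\nu_k^*(G)=\nu^*(\mathcal H).$$ If $M\ge\tau(\mathcal H)$, then $\tau_k(G)=\tau(\mathcal H)$; and, for every integer $b\ge1$, if $M\ge b$, then $\nu_k^{1/b}(G)=\nu_b^{\mathbb Z}(\mathcal H)$. In particular, if an integer $B\ge1$ is prescribed and $M\ge\max\{\tau(\mathcal H),B\}$, then the same graph $G$ satisfies $$\tau_k(G)=\tau(\mathcal H),\qquad \nu_k^*(G)=\nu^*(\mathcal H),\qquad \nu_k^{1/c}(G)=\nu_c^{\mathbb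 Z}(\mathcal H)\quad(1\le c\le B).$$
   Context: All graphs are finite and simple; all hypergraphs are finite with nonempty hyperedges. A clutter is a hypergraph in which no edge properly contains another; every nonempty clutter $\mathcal H$ (one with at least one edge) is taken on its support $V(\mathcal H)=\bigcup_{e\in E(\mathcal H)}e$. $\chi$ denotes chromatic number and $\omega$ clique number. For an integer $k\ge2$, an odd cycle $C$ of a graph $G$ (a cycle subgraph of odd length, not necessarily induced) is called $k$-bad if $\chi(G[V(C)])\ge k+1$, where $G[V(C)]$ is the subgraph of $G$ induced by $V(C)$. $\mathcal C_k(G)$ denotes the family of $k$-bad odd cycles of $G$. For $T\subseteq V(G)$ and a cycle $C$, $\operatorname{tr}_T(C)=V(C)\cap T$. Parameters of a family $\mathcal F$ of nonempty subsets of a ground set $V$ (applied to a clutter $\mathcal H$ via $\mathcal F=E(\mathcal H)$, $V=V(\mathcal H)$): - $\tau(\mathcal F)=\min\{|X|:X\subseteq V,\ X\cap F\neq\emptyset\text{ for every }F\in\mathcal F\}$; - for $b\in\mathbb N$, $b\ge1$, $\nu_b^{\mathbb Z}(\mathcal F)=\max\{\sum_{F\in\mathcal F}z_F: z_F\in\mathbb Z_{\ge0},\ \sum_{F\ni v}z_F\le b\text{ for every }v\in V\}$; - $\nu^*(\mathcal F)=\max\{\sum_{F\in\mathcal F}y_F: y_F\in\mathbb R_{\ge0},\ \sum_{F\ni v}y_F\le1\text{ for every }v\in V\}$. For a graph $G$: $\tau_k(G)=\tau(\{V(C):C\in\mathcal C_k(G)\})$ with ground set $V(G)$; $\nu_k^{1/b}(G)$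 is the maximum cardinality of a set of distinct cycles from $\mathcal C_k(G)$ such that every vertex of $G$ lies in at most $b$ of them; $\nu_k^*(G)=\nu^*(\{V(C):C\in\mathcal C_k(G)\})$ is the fractional packing number of the cycle-vertex hypergraph. *)

(* Defs.v *)
From mathcomp Require Import all_boot all_order all_algebra.
From mathcomp Require Import all_classical all_reals all_analysis.
From mathcomp Require Import fintype finset.

Set Implicit Arguments.
Unset Strict Implicit.
Unset Printing Implicit Defensive.

Import Order.TTheory GRing.Theory Num.Theory.
Import numFieldNormedType.Exports.

Local Open Scope ring_scope.
Local Open Scope nat_scope.

(** * Finite simple graphs *)

Record sgraph := SGraph {
  vertex :> finType;
  adj : rel vertex;
  adj_sym : symmetric adj;
  adj_irr : irreflexive adj }.

Lemma induced_sym (G : sgraph) (A : {set G}) :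
  symmetric (fun x y : {x : G | x \in A} => adj (val x) (val y)).
Proof. by move=> x y; apply: adj_sym. Qed.

Lemma induced_irr (G : sgraph) (A : {set G}) :
  irreflexive (fun x y : {x : G | x \in A} => adj (val x) (val y)).
Proof. by move=> x; apply: adj_irr. Qed.

Definition induced_sgraph (G : sgraph) (A : {set G}) : sgraph :=
  SGraph (@induced_sym G A) (@induced_irr G A).

Definition edges (G : sgraph) : {set {set G}} :=
  [set [set p.1; p.2] | p : G * G & adj p.1 p.2].

Definition independent (G : sgraph) (A : {set G}) : bool :=
  [forall x in A, forall y in A, ~~ adj x y].

Definition clique (G : sgraph) (A : {set G}) : bool :=
  [forall x in A, forall y in A, (x != y) ==> adj x y].

Definition omega (G : sgraph) : nat := \max_(A : {set G} | clique A) #|A|.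

Definition colorable (G : sgraph) (k : nat) : bool :=
  [exists f : {ffun G -> 'I_k}, forall x, forall y, adj x y ==> (f x != f y)].

Lemma ex_colorable (G : sgraph) : exists k, colorable G k.
Proof.
exists #|G|; apply/existsP; exists [ffun x => enum_rank x].
apply/forallP => x; apply/forallP => y; apply/implyP => xy.
rewrite !ffunE; apply: contraTneq xy => /enum_rank_inj ->.
by rewrite adj_irr.
Qed.

Definition chi (G : sgraph) : nat := ex_minn (ex_colorable G).

Definition sgraph_connected (G : sgraph) : bool :=
  (0 < #|G|) && [forall x : G, forall y : G, connect (@adj G) x y].

Definition k_connected (k : nat) (G : sgraph) : bool :=
  (k < #|G|) &&
  [forall X : {set G}, (#|X| < k) ==> sgraph_connected (induced_sgraph (~: X))].

(** * Cycles *)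

(* A cycle subgraph has no isolated vertices, so it is identified with its
   edge set C: distinct cycles may have the same vertex set, and V(C) is
   [cover C]. The length of C is [#|C|]. *)
Definition is_cycle (G : sgraph) (C : {set {set G}}) : Prop :=
  exists c : seq G,
    [/\ ucycle (@adj G) c, 2 < size c & C = [set [set x; next c x] | x in c]].

Definition bad_cycles (k : nat) (G : sgraph) : {set {set {set G}}} :=
  [set C | [&& `[< is_cycle C >], odd #|C| & k.+1 <= chi (induced_sgraph (cover C))]].

Definition trace (G : sgraph) (T : {set G}) (C : {set {set G}}) : {set G} :=
  cover C :&: T.

(** * Clutters, packing and covering parameters *)

Definition clutter (U : finType) (H : {set {set U}}) : Prop :=
  set0 \notin H /\ (forall e f, e \in H -> f \in H -> ~~ (f \proper e)).

Definition minimal_members (U : finType) (F : {set {set U}}) : {set {set U}} :=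
  [set A | minset [in F] A].

(* In the three parameters below, V is the ground set and F a family of
   nonempty subsets of V; hence V itself is a hitting set. *)
Definition hitting_set (U : finType) (V : {set U}) (F : {set {set U}})
    (X : {set U}) : bool :=
  (X \subset V) && [forall A in F, X :&: A != set0].

Definition tau (U : finType) (V : {set U}) (F : {set {set U}}) : nat :=
  #|[arg min_(X < V | hitting_set V F X) #|X|]|.

(* The multiplicities range over 'I_b.+1: every member of F contains a vertex
   of V, so no multiplicity in a feasible z exceeds b (see nuZ_max). *)
Definition nuZ (U : finType) (b : nat) (V : {set U}) (F : {set {set U}}) : nat :=
  \max_(z : {ffun {set U} -> 'I_b.+1} |
        [forall v in V, \sum_(A in F | v \in A) z A <= b]) \sum_(A in F) z A.

Lemma nuZ_max (U : finType) (b : nat) (V : {set U}) (F : {set {set U}})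
    (z : {set U} -> nat) :
  {in F, forall A, A != set0 /\ A \subset V} ->
  {in V, forall v, \sum_(A in F | v \in A) z A <= b} ->
  \sum_(A in F) z A <= nuZ b V F.
Proof.
move=> FV zb.
have zB A : A \in F -> z A <= b.
  move=> AF; have [/set0Pn[v vA] AV] := FV _ AF.
  apply: leq_trans (zb v (subsetP AV _ vA)).
  by rewrite (bigD1 A) ?AF //= leq_addr.
pose z' : {ffun {set U} -> 'I_b.+1} := [ffun A => inord (z A)].
have zE A : A \in F -> z' A = z A :> nat.
  by move=> AF; rewrite ffunE inordK // ltnS zB.
have -> : \sum_(A in F) z A = \sum_(A in F) z' A.
  by apply: eq_bigr => A AF; rewrite zE.
apply: (@leq_bigmax_cond _ _ (fun z : {ffun _ -> 'I_b.+1} => \sum_(A in F) z A)).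
apply/forallP => v; apply/implyP => vV.
rewrite (eq_bigr z); first exact: zb.
by move=> A /andP[AF _]; rewrite zE.
Qed.

Definition frac_packing (R : realType) (U : finType) (V : {set U})
    (F : {set {set U}}) (y : {set U} -> R) : Prop :=
  {in F, forall A, 0 <= y A}%R /\
  {in V, forall v, \sum_(A in F | v \in A) y A <= 1}%R.

(* The supremum is attained (see nustar_max). *)
Definition nustar (R : realType) (U : finType) (V : {set U})
    (F : {set {set U}}) : R :=
  sup [set s | exists2 y, @frac_packing R U V F y
                        & s = \sum_(A in F) y A]%R%classic.

Lemma nustar_max (R : realType) (U : finType) (V : {set U}) (F : {set {set U}}) :
  {in F, forall A, A != set0 /\ A \subset V} ->
  exists2 y, @frac_packing R U V F y
    & (nustar R V F = \sum_(A in F) y A)%R /\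
      forall y', @frac_packing R U V F y' ->
        (\sum_(A in F) y' A <= \sum_(A in F) y A)%R.
Proof.
move=> FV.
pose T := prod_topology (fun _ : {set U} => R : topologicalType).
pose S (P : pred {set U}) (y : T) : R := (\sum_(A in F | P A) y A)%R.
have Sc P : continuous (S P).
  suff rc (r : seq {set U}) : continuous (fun y : T => \sum_(A <- r) y A)%R.
    have -> : S P = fun y : T =>
        (\sum_(A <- [seq A <- index_enum _ | (A \in F) && P A]) y A)%R.
      by apply/funext => y; rewrite /S big_filter.
    exact: rc.
  elim: r => [|A r IH].
    have -> : (fun y : T => \sum_(A <- [::]) y A)%R = cst 0%R.
      by apply/funext => y; rewrite big_nil.
    exact: cst_continuous.
  have -> : (fun y : T => \sum_(B <- A :: r) y B)%R =
            (fun y : T => y A + \sum_(B <- r) y B)%R.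
    by apply/funext => y; rewrite big_cons.
  move=> y; apply: cvgD (IH y).
  exact: (@proj_continuous _ (fun _ => R : topologicalType) A y).
pose K0 : set T := [set y : T | forall A : {set U}, `[0%R, 1%R]%classic (y A)]%classic.
have K0E y : K0 y <-> forall A, (0 <= y A <= 1)%R.
  by split=> yK A; have := yK A; rewrite /= in_itv /=.
have K0c : compact K0.
  apply: (@tychonoff _ (fun _ => R : topologicalType) (fun _ => `[0%R, 1%R]%classic)).
  by move=> _; exact: segment_compact.
pose K : set T := (K0 `&` \bigcap_(v in [set v | v \in V])
   (S (fun A => v \in A) @^-1` [set x | x <= 1]%R))%classic.
have Kc : compact K.
  apply: compact_closedI => //; apply: closed_bigI => v _.
  apply: preimage_closed; last exact: closed_le.
  by move=> y _; apply: Sc.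
have K0' : (K !=set0)%classic.
  exists (fun=> 0%R); split.
    by apply/K0E => A; rewrite lexx ler01.
  by move=> v _ /=; rewrite /S big1 // ler01.
have [y yK ymax] := compact_EVT_max K0' Kc (continuous_subspaceT (Sc predT)).
have SE z : S predT z = (\sum_(A in F) z A)%R.
  by rewrite /S; apply: eq_bigl => A; rewrite andbT.
have yP : @frac_packing R U V F y.
  move: yK => /set_mem[/K0E yK0 yKV]; split.
    by move=> A _; have /andP[] := yK0 A.
  by move=> v vV; exact: yKV.
have ymx y' : @frac_packing R U V F y' ->
    (\sum_(A in F) y' A <= \sum_(A in F) y A)%R.
  move=> [y'0 y'1]; pose y'' A := if A \in F then y' A else 0%R.
  have y''E (P : pred {set U}) : (\sum_(A in F | P A) y'' A = \sum_(A in F | P A) y' A)%R.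
    by apply: eq_bigr => A /andP[AF _]; rewrite /y'' AF.
  have -> : (\sum_(A in F) y' A = S predT y'')%R.
    by rewrite SE; apply: eq_bigr => A AF; rewrite /y'' AF.
  rewrite -SE; apply: ymax; apply/mem_set; split.
    apply/K0E => A; rewrite /y''; case: ifP => AF; last by rewrite lexx ler01.
    rewrite y'0 //=; have [/set0Pn[v vA] AV] := FV _ AF.
    apply: le_trans (y'1 v (subsetP AV _ vA)).
    rewrite (bigD1 A) ?AF //= lerDl sumr_ge0 // => B /andP[/andP[BF _] _].
    exact: y'0.
  by move=> v vV /=; rewrite /S y''E; exact: y'1.
exists y => //; split=> //; rewrite /nustar.
apply/eqP; rewrite eq_le; apply/andP; split.
  apply: ge_sup; first by exists (\sum_(A in F) y A)%R; exists y.
  by move=> _ [y' /ymx y'm ->].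
apply: ub_le_sup; last by exists y.
by exists (\sum_(A in F) y A)%R => _ [y' /ymx y'm ->].
Qed.

Definition bad_vertex_sets (k : nat) (G : sgraph) : {set {set G}} :=
  [set cover C | C in bad_cycles k G].

Definition tau_k (k : nat) (G : sgraph) : nat :=
  tau [set: G] (bad_vertex_sets k G).

Definition nustar_k (R : realType) (k : nat) (G : sgraph) : R :=
  nustar R [set: G] (bad_vertex_sets k G).

Definition nu_k (b k : nat) (G : sgraph) : nat :=
  \max_(S : {set {set {set G}}} |
        (S \subset bad_cycles k G) &&
        [forall v : G, #|[set C in S | v \in cover C]| <= b]) #|S|.

(* Main.v *)
Require Import Defs.
From mathcomp Require Import all_boot all_order all_algebra reals.
From mathcomp Require Import fintype finset boolp zify.
From mathcomp Require classical_sets.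

Set Implicit Arguments.
Unset Strict Implicit.
Unset Printing Implicit Defensive.

Import Order.TTheory GRing.Theory Num.Theory.

(** Every edge e of the clutter, in M copies, is planted in the graph as a gadget
    that cannot be k-coloured, but can be as soon as one vertex of e is removed,
    even when all the other vertices of e must get the same colour 0. Colouring
    all of T with 0 then makes the gadgets independent of each other, so an
    induced subgraph that misses a vertex of every edge is k-colourable, while
    every gadget is an obstruction whose trace on T is exactly its edge.

    The gadget is a closed chain of diamonds, in the style of the Moser spindle.
    A diamond is a clique on k-1 vertices joined completely to two hubs, and in a
    k-colouring it forces its two hubs to agree. Consecutive diamonds share a hub
    and the first and the last hub are adjacent, so the chain is not k-colourable
    ([spindle_not_colorable]); deleting one vertex of one diamond lets the colour
    of the hubs change there ([split_coloring_proper]). The vertices of e are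
    placed one per diamond. Having at least two diamonds keeps the two adjacent
    end hubs without a common neighbour, hence no clique exceeds k.

    All remaining requirements come from connectors: for every gadget label and
    every ordered pair of distinct vertices p, q of the graph built so far, one
    more vertex adjacent to p and q only. As k is at least 3, vertices of degree 2
    never obstruct a k-colouring, nor do they create cliques larger than k.
    - Two connectors join any two old vertices, so the graph is 2-connected.
    - Connectors outnumber the old edges, and each brings two new edges, so the
      number of edges is at most three times the number of connectors.
    - Listing the vertices of a gadget from the first to the last hub and
      interposing the connectors with its own label gives a closed walk through
      adjacent end hubs with 2l-1 vertices, l being the size of the gadget: an
      odd cycle that spans the gadget, and whose vertices outside T are private
      to the gadget ([tour_bad], [tourP]).

    The equalities between parameters use only these properties of traces
    (section [ClutterRealization]). A bad cycle contains an edge of the clutter,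
    so hitting sets of the clutter hit all bad cycles, and a packing of bad cycles
    projects to a packing of edges; conversely a packing of edges lifts to the
    M cycles of each edge, whose vertices outside T carry no conflict. A
    hitting set of the bad cycles either hits every edge within T, or else spends
    a separate vertex on each of the M cycles of some edge. *)

(** * Colourings, cliques and cycles *)

(** Colours are read as natural numbers below k, so that colourings can be given by
    arithmetic formulas. *)
Lemma colorableP (G : sgraph) (k : nat) :
  reflect (exists f : G -> nat, (forall x, f x < k) /\
                                (forall x y, adj x y -> f x != f y))
          (colorable G k).
Proof.
apply: (iffP existsP) => [[f /forallP fP]|[f [fk fP]]].
  exists (fun x => f x : nat); split=> [x|x y xy]; first exact: ltn_ord.
  by have /forallP/(_ y) := fP x; rewrite xy /= val_eqE.
exists [ffun x => Ordinal (fk x)].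
apply/forallP => x; apply/forallP => y; apply/implyP => xy.
by rewrite !ffunE -val_eqE fP.
Qed.

(** The colouring lives on the whole graph and is constrained on A only, which avoids
    the subtype of vertices of the induced subgraph. *)
Lemma induced_colorableP (G : sgraph) (A : {set G}) (k : nat) :
  reflect (exists f : G -> nat, {in A, forall x, f x < k} /\
                                {in A &, forall x y, adj x y -> f x != f y})
          (colorable (induced_sgraph A) k).
Proof.
apply: (iffP (colorableP _ _)) => [[f [fk fP]]|[f [fk fP]]]; last first.
  exists (fun x => f (val x)); split=> [x|x y xy]; first exact: fk (valP x).
  exact: fP (valP x) (valP y) xy.
exists (fun x => if insub x is Some x' then f x' else 0); split.
  by move=> x xA; rewrite insubT.
move=> x y xA yA xy; rewrite !insubT; exact: fP.
Qed.

Lemma leq_colorable (G : sgraph) (k l : nat) :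
  k <= l -> colorable G k -> colorable G l.
Proof.
move=> kl /colorableP[f [fk fP]]; apply/colorableP; exists f; split=> // x.
exact: leq_trans kl.
Qed.

Lemma chi_leq (G : sgraph) (k : nat) : (chi G <= k) = colorable G k.
Proof.
rewrite /chi; case: ex_minnP => m mG minm; apply/idP/idP; last exact: minm.
by move=> mk; apply: leq_colorable mG.
Qed.

Lemma independentP (G : sgraph) (A : {set G}) :
  reflect {in A &, forall x y, ~~ adj x y} (independent A).
Proof.
apply: (iffP forallP) => [h x y xA yA|h x].
  by have := h x; rewrite xA => /forallP/(_ y); rewrite yA.
apply/implyP => xA; apply/forallP => y; apply/implyP; exact: h.
Qed.

Lemma cliqueP (G : sgraph) (A : {set G}) :
  reflect {in A &, forall x y, x != y -> adj x y} (clique A).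
Proof.
apply: (iffP forallP) => [h x y xA yA|h x].
  by have := h x; rewrite xA => /forallP/(_ y)/implyP/(_ yA)/implyP.
apply/implyP => xA; apply/forallP => y; apply/implyP => yA; apply/implyP; exact: h.
Qed.

Lemma leq_omega (G : sgraph) (m : nat) :
  (forall A : {set G}, clique A -> #|A| <= m) -> omega G <= m.
Proof. by move=> h; apply/bigmax_leqP. Qed.

Lemma clique_leq_omega (G : sgraph) (A : {set G}) : clique A -> #|A| <= omega G.
Proof. by move=> cA; apply: (@leq_bigmax_cond _ _ (fun A : {set G} => #|A|)). Qed.

(** An independent set can be given one additional colour of its own. *)
Lemma colorable_independent_extension (G : sgraph) (T : {set G}) (k : nat) :
  independent T -> colorable (induced_sgraph (~: T)) k -> colorable G k.+1.
Proof.
move=> /independentP Ti /induced_colorableP[f [fk fP]]; apply/colorableP.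
exists (fun x => if x \in T then k else f x); split=> [x|x y xy].
  by case: ifPn => // xT; rewrite ltnS ltnW // fk // inE.
case: ifPn => xT; case: ifPn => yT.
- by move: (Ti _ _ xT yT); rewrite xy.
- by rewrite gtn_eqF // fk // inE.
- by rewrite ltn_eqF // fk // inE.
by rewrite fP // inE.
Qed.

Definition cycle_edges (G : sgraph) (c : seq G) : {set {set G}} :=
  [set [set x; next c x] | x in c].

Lemma cover_cycle_edges (G : sgraph) (c : seq G) : cover (cycle_edges c) = [set x in c].
Proof.
apply/setP => x; rewrite inE; apply/bigcupP/idP => [[e]|xc].
  by move=> /imsetP[y yc ->]; rewrite !inE => /orP[]/eqP-> //; rewrite mem_next.
by exists [set x; next c x]; [apply: imset_f|rewrite !inE eqxx].
Qed.

(** An edge {x, next x} determines x: otherwise next (next x) = x for some x, which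
    a duplicate-free cycle of size at least 3 excludes. *)
Lemma card_cycle_edges (G : sgraph) (c : seq G) :
  uniq c -> 2 < size c -> #|cycle_edges c| = size c.
Proof.
move=> Uc sc; rewrite card_in_imset; first by rewrite (card_uniqP Uc).
move=> x y xc yc exy; apply/eqP; apply/negPn/negP => nxy.
have xE : x = next c y.
  have : x \in [set y; next c y] by rewrite -exy !inE eqxx.
  by rewrite !inE (negPf nxy) => /eqP.
have yE : y = next c x.
  have : y \in [set x; next c x] by rewrite exy !inE eqxx.
  by rewrite !inE eq_sym (negPf nxy) => /eqP.
have [i s cE] := rot_to xc.
have Us : uniq (x :: s) by rewrite -cE rot_uniq.
have ss : 2 < size (x :: s) by rewrite -cE size_rot.
have nE : next c =1 next (x :: s) by move=> z; rewrite -cE next_rot.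
move: xE yE; rewrite !nE; case: s Us ss {cE nE} => [|a [|b s]] //= Us _.
rewrite eqxx => xE yE; move: xE; rewrite yE eqxx; case: eqP => [ax _|_ xb].
  by rewrite ax !inE eqxx in Us.
by rewrite xb !inE eqxx orbT in Us.
Qed.

Lemma mem_bad_cyclesP (k : nat) (G : sgraph) (C : {set {set G}}) :
  reflect [/\ is_cycle C, odd #|C| & ~~ colorable (induced_sgraph (cover C)) k]
          (C \in bad_cycles k G).
Proof.
rewrite inE -chi_leq -ltnNge; apply: (iffP and3P) => -[h1 h2 h3]; split=> //.
  exact/asboolP.
exact/asboolP.
Qed.

(** Walks that avoid X are taken in the ambient graph; they lift to the subtype that
    carries the induced subgraph. A set of fewer than two vertices is presented as
    one whose elements are all equal. *)
Lemma two_connectedP (G : sgraph) :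
  2 < #|G| ->
  (forall X : {set G}, {in X &, forall x y, x = y} ->
     {in ~: X &, forall x y,
        connect (fun a b => [&& a \notin X, b \notin X & adj a b]) x y}) ->
  k_connected 2 G.
Proof.
move=> G2 h; rewrite /k_connected G2; apply/forallP => X; apply/implyP => X1.
have Xe : {in X &, forall x y, x = y}.
  move=> x y xX yX; apply/eqP; apply: contraTT X1 => nxy.
  rewrite -leqNgt; have <- : #|[set x; y]| = 2 by rewrite cards2 nxy.
  by apply: subset_leq_card; apply/subsetP => z; rewrite !inE => /orP[]/eqP->.
apply/andP; split.
  have /set0Pn[x xX] : ~: X != set0.
    apply: contraTneq X1 => X0; rewrite -leqNgt.
    by rewrite -[X]setCK X0 setC0 cardsT ltnW.
  by apply/card_gt0P; exists (Sub x xX).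
apply/forallP => x; apply/forallP => y.
have /connectP[p pP yE] := h X Xe _ _ (valP x) (valP y).
elim: p x pP yE => [|z p IH] x /=.
  by move=> _ /val_inj ->; exact: connect0.
move=> /andP[/and3P[xX zX xz] zp] yE.
have zX' : z \in ~: X by rewrite inE.
apply: connect_trans (IH (Sub z zX') zp yE).
by apply: connect1.
Qed.

(** * Parameters of a clutter realized by bad cycles *)

Lemma ground_hitting_set (U : finType) (V : {set U}) (F : {set {set U}}) :
  {in F, forall A, A != set0 /\ A \subset V} -> hitting_set V F V.
Proof.
move=> FV; rewrite /hitting_set subxx; apply/forallP => A; apply/implyP => AF.
by have [A0 /setIidPr ->] := FV A AF.
Qed.

Lemma tau_leq (U : finType) (V X : {set U}) (F : {set {set U}}) :
  {in F, forall A, A != set0 /\ A \subset V} ->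
  hitting_set V F X -> tau V F <= #|X|.
Proof.
move=> /ground_hitting_set VF XF; rewrite /tau.
by case: arg_minnP => // Y _; apply.
Qed.

Lemma tau_attained (U : finType) (V : {set U}) (F : {set {set U}}) :
  {in F, forall A, A != set0 /\ A \subset V} ->
  exists2 X, hitting_set V F X & #|X| = tau V F.
Proof.
move=> /ground_hitting_set VF; rewrite /tau.
by case: arg_minnP => // Y ? _; exists Y.
Qed.

Lemma hitting_setP (U : finType) (V : {set U}) (F : {set {set U}}) (X : {set U}) :
  reflect (X \subset V /\ forall A, A \in F -> exists2 x, x \in X & x \in A)
          (hitting_set V F X).
Proof.
apply: (iffP andP) => -[XV h]; split=> //.
  move=> A AF; have := forallP h A; rewrite AF => /set0Pn[x].
  by rewrite inE => /andP[]; exists x.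
apply/forallP => A; apply/implyP => /h[x xX xA].
by apply/set0Pn; exists x; rewrite inE xX.
Qed.

Section ClutterRealization.

Variables (k : nat) (G : sgraph) (U : finType) (H : {set {set U}}) (M : nat).
Variables (iota : U -> G) (C : {set U} -> 'I_M -> {set {set G}}).

Let V := cover H.
Let T := iota @: V.

Hypothesis clutterH : clutter H.
Hypothesis M_gt0 : 0 < M.
Hypothesis iota_inj : {in V &, injective iota}.
Hypothesis colorable_edge_free : forall X : {set G},
  (forall e, e \in H -> ~~ (iota @: e \subset X :&: T)) ->
  colorable (induced_sgraph X) k.
Hypothesis C_bad : forall e j, e \in H -> C e j \in bad_cycles k G.
Hypothesis C_trace : forall e j, e \in H -> trace T (C e j) = iota @: e.
Hypothesis C_inj : forall e, e \in H -> injective (C e).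
Hypothesis C_disjoint : forall e f i j, e \in H -> f \in H -> (e, i) != (f, j) ->
  [disjoint cover (C e i) :\: T & cover (C f j) :\: T].

Let edge_sub e : e \in H -> e \subset V.
Proof. by move=> eH; rewrite /V /cover (bigcup_sup e). Qed.

Let edge_memV e u : e \in H -> u \in e -> u \in V.
Proof. by move=> eH; apply/subsetP/edge_sub. Qed.

Let edge_neq0 e : e \in H -> e != set0.
Proof. by move=> eH; apply: contraTneq eH => ->; case: clutterH. Qed.

Let edge_ok : {in H, forall e, e != set0 /\ e \subset V}.
Proof. by move=> e eH; rewrite edge_sub ?edge_neq0. Qed.

Let mem_iota_edge e u : e \in H -> u \in V -> (iota u \in iota @: e) = (u \in e).
Proof.
move=> eH uV; apply/imsetP/idP => [[v ve /iota_inj -> //]|ue]; last by exists u.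
exact: edge_memV ve.
Qed.

Let iota_subset e f : e \in H -> f \in H -> iota @: e \subset iota @: f -> e \subset f.
Proof.
move=> eH fH /subsetP ef; apply/subsetP => u ue.
by rewrite -mem_iota_edge ?(edge_memV eH) // ef ?imset_f.
Qed.

Let mem_C e j u : e \in H -> u \in V -> (iota u \in cover (C e j)) = (u \in e).
Proof.
move=> eH uV; rewrite -mem_iota_edge // -(C_trace j eH) inE.
by rewrite (imset_f iota uV) andbT.
Qed.

Let mem_C_inj v e f i j : v \notin T -> e \in H -> f \in H ->
  v \in cover (C e i) -> v \in cover (C f j) -> (e, i) = (f, j).
Proof.
move=> vT eH fH ve vf; apply/eqP; apply/negPn/negP => /(C_disjoint eH fH).
by rewrite disjoint_subset => /subsetP/(_ v); rewrite !inE vT ve vf => /(_ isT).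
Qed.

(** A bad cycle spans a graph that is not k-colourable, so its vertex set cannot be
    free of edges. This is the only way in which colourability enters below. *)
Lemma bad_cycle_contains_edge B : B \in bad_cycles k G ->
  exists2 e, e \in H & iota @: e \subset trace T B.
Proof.
move=> /mem_bad_cyclesP[_ _ nc].
have [/existsP[e /andP[]]|/existsPn h] := boolP [exists e in H, iota @: e \subset trace T B].
  by exists e.
case/negP: nc; apply: colorable_edge_free => e eH.
by have := h e; rewrite eH.
Qed.

(** A chosen edge inside a vertex set: the projection from bad cycles to edges. *)
Let edge_in (A : {set G}) : {set U} :=
  odflt set0 [pick e in H | iota @: e \subset A].

Let edge_inP B : B \in bad_cycles k G ->
  edge_in (cover B) \in H /\ iota @: edge_in (cover B) \subset cover B.
Proof.
move=> /bad_cycle_contains_edge[e eH]; rewrite /trace subsetI => /andP[eB _].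
by rewrite /edge_in; case: pickP => [f /andP[]//|/(_ e)]; rewrite eH eB.
Qed.

Lemma bad_vertex_sets_ok :
  {in bad_vertex_sets k G, forall A, A != set0 /\ A \subset [set: G]}.
Proof.
move=> _ /imsetP[B Bb ->]; split; last exact: subsetT.
have [eH eB] := edge_inP Bb; have /set0Pn[u ue] := edge_neq0 eH.
by apply/set0Pn; exists (iota u); apply: (subsetP eB); apply: imset_f.
Qed.

Let j0 : 'I_M := Ordinal M_gt0.

Lemma minimal_traces :
  [set iota @: e | e : {set U} in H]
    = minimal_members [set trace T B | B in bad_cycles k G].
Proof.
have memtr e : e \in H -> iota @: e \in [set trace T B | B in bad_cycles k G].
  by move=> eH; rewrite -(C_trace j0 eH); apply: imset_f; exact: C_bad.
apply/setP => A; rewrite inE; apply/imsetP/minsetP => [[e eH ->]|[]].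
  split=> [|A' /=]; first exact: memtr.
  move=> /imsetP[B Bb ->] Be; apply/eqP; rewrite eqEsubset Be.
  have [f fH fB] := bad_cycle_contains_edge Bb.
  have fe := iota_subset fH eH (subset_trans fB Be).
  have [_ /(_ e f eH fH)] := clutterH; rewrite properE fe /= negbK => ef.
  exact: subset_trans (imsetS _ ef) fB.
move=> /imsetP[B Bb ->] minB; have [f fH fB] := bad_cycle_contains_edge Bb.
by exists f => //; rewrite (minB _ (memtr f fH) fB).
Qed.

(** Both sets of attainable values are equal: a packing of bad cycles is pushed
    forward along [edge_in], and a packing y of the edges is lifted by giving weight
    y e to the cycle C e 0. At a vertex outside T the lift weighs at most a single
    y e, which is at most 1 because e is nonempty. *)
Lemma nustar_k_realization (R : realType) : nustar_k R k G = nustar R V H.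
Proof.
rewrite /nustar_k /nustar; congr (reals.sup _).
apply/classical_sets.seteqP; split=> s [y [y0 y1] ->].
  pose y' e : R := (\sum_(A in bad_vertex_sets k G | edge_in A == e) y A)%R.
  have edgeF A : A \in bad_vertex_sets k G -> edge_in A \in H /\ iota @: edge_in A \subset A.
    by move=> /imsetP[B /edge_inP Bb ->].
  exists y'; last first.
    by rewrite (partition_big edge_in [in H]) // => A /edgeF[].
  split=> [e _|u uV]; first by apply: sumr_ge0 => A /andP[/y0].
  have -> : (\sum_(e in H | u \in e) y' e =
             \sum_(A in bad_vertex_sets k G | u \in edge_in A) y A)%R.
    rewrite [RHS](partition_big edge_in (fun e => (e \in H) && (u \in e))) /=; last first.
      by move=> A /andP[/edgeF[-> _] ->].
    apply: eq_bigr => e /andP[eH ue]; apply: eq_bigl => A.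
    by rewrite -andbA; congr (_ && _); case: eqP => [->|]; rewrite ?ue ?andbF.
  apply: le_trans (y1 (iota u) (in_setT _)).
  rewrite big_mkcondr [leRHS]big_mkcondr /=; apply: ler_sum => A AF.
  case: ifP => [ue|_]; last by case: ifP => // _; exact: y0.
  have [_ /subsetP/(_ (iota u))] := edgeF A AF.
  by rewrite imset_f // => -> .
pose D e := cover (C e j0).
pose y' A : R := (\sum_(e in H | D e == A) y e)%R.
have DF e : e \in H -> D e \in bad_vertex_sets k G.
  by move=> eH; apply: imset_f; exact: C_bad.
exists y'; last by rewrite (partition_big D [in bad_vertex_sets k G]).
split=> [A _|v _]; first by apply: sumr_ge0 => e /andP[/y0].
have -> : (\sum_(A in bad_vertex_sets k G | v \in A) y' A =
           \sum_(e in H | v \in D e) y e)%R.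
  rewrite [RHS](partition_big D (fun A => (A \in bad_vertex_sets k G) && (v \in A))) /=.
    apply: eq_bigr => A /andP[AF vA]; apply: eq_bigl => e.
    by rewrite -andbA; congr (_ && _); case: eqP => [->|]; rewrite ?vA ?andbF.
  by move=> e /andP[/DF -> ->].
have [/imsetP[u uV ->]|vT] := boolP (v \in T).
  rewrite (eq_bigl (fun e => (e \in H) && (u \in e))); first exact: y1.
  by move=> e; apply: andb_id2l => eH; rewrite mem_C.
have [/existsP[e /andP[eH ve]]|/existsPn nD] := boolP [exists e in H, v \in D e].
  rewrite (big_pred1 e) => [|f].
    have /set0Pn[u ue] := edge_neq0 eH.
    apply: le_trans (y1 u (edge_memV eH ue)).
    rewrite (bigD1 e) ?eH //= lerDl; apply: sumr_ge0 => f /andP[/andP[fH _] _].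
    exact: y0.
  apply/andP/eqP => [[fH vf]|-> //].
  by have [] := mem_C_inj vT fH eH vf ve.
rewrite big_pred0 ?ler01 // => e.
by apply/negbTE; exact: nD.
Qed.

(** If the part of a hitting set X lying in T misses an edge e, then X meets each of
    the M cycles C e j outside T, where they are disjoint, and so has at least
    M elements. *)
Lemma tau_k_realization : tau V H <= M -> tau_k k G = tau V H.
Proof.
move=> tauM; rewrite /tau_k; apply/eqP; rewrite eqn_leq; apply/andP; split.
  have [X /hitting_setP[XV hX] <-] := tau_attained edge_ok.
  apply: leq_trans (leq_imset_card iota X).
  apply: tau_leq bad_vertex_sets_ok _; apply/hitting_setP; split=> [|A]; first exact: subsetT.
  move=> /imsetP[B /edge_inP[eH /subsetP eB] ->].
  have [u uX ue] := hX _ eH.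
  by exists (iota u); [exact: imset_f|apply: eB; exact: imset_f].
have [X /hitting_setP[_ hX] <-] := tau_attained bad_vertex_sets_ok.
pose Y := [set u in V | iota u \in X].
have YX : #|Y| <= #|X|.
  rewrite -(card_in_imset (f := iota) (D := Y)) => [|u v]; last first.
    by rewrite !inE => /andP[uV _] /andP[vV _]; exact: iota_inj.
  by apply: subset_leq_card; apply/subsetP => _ /imsetP[u + ->]; rewrite inE => /andP[].
have hXC e j : e \in H -> exists2 v, v \in X & v \in cover (C e j).
  by move=> eH; apply: hX; apply: imset_f; exact: C_bad.
have [Yhit|] := boolP (hitting_set V H Y).
  exact: leq_trans (tau_leq edge_ok Yhit) YX.
have YV : Y \subset V by apply/subsetP => u; rewrite inE => /andP[].
rewrite negb_and YV negb_forall => /existsP[e].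
rewrite negb_imply negbK => /andP[eH /eqP Ye].
apply: (leq_trans tauM).
have hXe j : exists v, [&& v \in X, v \notin T & v \in cover (C e j)].
  have [v vX vC] := hXC e j eH; exists v; rewrite vX vC andbT /=.
  apply/negP => /imsetP[u uV vE]; move: vC; rewrite vE mem_C // => ue.
  have : u \in Y :&: e by rewrite !inE uV ue -vE vX.
  by rewrite Ye inE.
pose g j := xchoose (hXe j).
have gP j : [/\ g j \in X, g j \notin T & g j \in cover (C e j)] := and3P (xchooseP (hXe j)).
have g_inj : injective g.
  move=> i j gij; have [_ giT gi] := gP i; have [_ _ +] := gP j.
  rewrite -gij => gj.
  by have [] := mem_C_inj giT eH eH gi gj.
rewrite -[M]card_ord -(card_imset _ g_inj).
by apply: subset_leq_card; apply/subsetP => _ /imsetP[j _ ->]; have [] := gP j.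
Qed.

(** A multiplicity z e is realized by the first z e of the cycles C e j, which exist
    since z e <= b <= M. *)
Lemma nu_k_realization b : 0 < b -> b <= M -> nu_k b k G = nuZ b V H.
Proof.
move=> b0 bM; apply/eqP; rewrite eqn_leq; apply/andP; split.
  apply/bigmax_leqP => S /andP[/subsetP SB /forallP Sb].
  pose z e := #|[set B in S | edge_in (cover B) == e]|.
  have zE (P : pred {set U}) :
      \sum_(e in H | P e) z e = #|[set B in S | P (edge_in (cover B))]|.
    rewrite -sum1dep_card.
    rewrite [RHS](partition_big (fun B => edge_in (cover B))
                   (fun e => (e \in H) && P e)) /=; last first.
      by move=> B /andP[/SB/edge_inP[-> _] ->].
    apply: eq_bigr => e /andP[eH Pe]; rewrite /z -sum1dep_card; apply: eq_bigl => B.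
    by rewrite -andbA; congr (_ && _); case: eqP => [->|]; rewrite ?Pe ?andbF.
  have -> : #|S| = \sum_(e in H) z e.
    rewrite (eq_bigl (fun e => (e \in H) && predT e)); last by move=> e; rewrite andbT.
    by rewrite zE; apply: eq_card => B; rewrite inE andbT.
  apply: nuZ_max edge_ok _ => u uV; rewrite zE.
  apply: leq_trans (Sb (iota u)); apply: subset_leq_card; apply/subsetP => B.
  rewrite !inE => /andP[BS ue]; rewrite BS /=.
  have [_ /subsetP] := edge_inP (SB B BS); apply; exact: imset_f.
apply/bigmax_leqP => z /forallP zb.
pose P := [set p : {set U} * 'I_M | (p.1 \in H) && (p.2 < z p.1)].
have cardP (Q : pred {set U}) :
    #|[set p in P | Q p.1]| = \sum_(e in H | Q e) z e.
  rewrite -sum1dep_card.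
  rewrite [LHS](partition_big (fun p : {set U} * 'I_M => p.1) (fun e => (e \in H) && Q e)) /=.
    apply: eq_bigr => e /andP[eH Qe].
    have zM : z e <= M by apply: leq_trans bM; rewrite -ltnS ltn_ord.
    rewrite sum1dep_card -[RHS]card_ord.
    have f_inj : injective (fun i : 'I_(z e) => (e, widen_ord zM i)).
      by move=> i j [ij]; apply: val_inj.
    rewrite -(card_imset _ f_inj); apply: eq_card => -[f j]; rewrite !inE /=.
    apply/idP/imsetP => [/andP[/andP[/andP[_ jz] _] /eqP fe]|[i _ [-> ->]]] /=.
      by subst f; exists (Ordinal jz) => //; congr (_, _); exact: val_inj.
    by rewrite eH Qe eqxx ltn_ord.
  by move=> p; rewrite inE => /andP[/andP[-> _] ->].
pose c (p : {set U} * 'I_M) := C p.1 p.2.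
(* The trace determines the edge, and C e is injective. *)
have c_inj : {in P &, injective c}.
  move=> [e i] [f j]; rewrite !inE /= => /andP[eH _] /andP[fH _] /= cE.
  have ef : e = f.
    by apply/eqP; rewrite eqEsubset !iota_subset //
         -(C_trace i eH) -(C_trace j fH) -[C e i]/(c (e, i)) cE.
  by subst f; congr (_, _); exact: (C_inj eH).
have cS : c @: P \subset bad_cycles k G.
  apply/subsetP => _ /imsetP[[e j] + ->].
  by rewrite inE => /andP[/= eH _]; exact: C_bad.
have card_thru v : #|[set B in c @: P | v \in cover B]| =
                   #|[set p in P | v \in cover (c p)]|.
  rewrite -(card_in_imset (f := c)); last first.
    by move=> p q; rewrite !inE => /andP[pP _] /andP[qP _]; apply: c_inj; rewrite inE.
  apply: eq_card => B; rewrite inE; apply/andP/imsetP => [[/imsetP[p pP ->] vp]|[p]].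
    by exists p => //; rewrite inE pP.
  by rewrite inE => /andP[pP vp] ->; rewrite imset_f.
have cb : [forall v, #|[set B in c @: P | v \in cover B]| <= b].
  apply/forallP => v; rewrite card_thru.
  have [/imsetP[u uV ->]|vT] := boolP (v \in T).
    have /implyP/(_ uV) := zb u; rewrite -cardP; apply: leq_trans.
    apply: subset_leq_card; apply/subsetP => -[e j]; rewrite !inE /=.
    by move=> /andP[/andP[eH ->]]; rewrite mem_C // eH.
  apply: leq_trans b0; apply/card_le1P => -[e i].
  rewrite !inE /= => /andP[/andP[eH iz] ve] [f j]; rewrite !inE /=.
  apply/idP/eqP => [/andP[/andP[fH _] vf]|].
    exact: mem_C_inj vT fH eH vf ve.
  by move=> [-> ->]; rewrite eH iz ve.
have -> : \sum_(e in H) z e = #|c @: P|.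
  rewrite (card_in_imset c_inj) (eq_bigl (fun e => (e \in H) && predT e)); last first.
    by move=> e; rewrite andbT.
  by rewrite -cardP; apply: eq_card => p; rewrite inE andbT.
by apply: leq_bigmax_cond; rewrite cS.
Qed.

End ClutterRealization.

(** * The spindle gadget *)

Section Spindle.

Variables m n : nat.

(** The left summand holds the hubs, joined in a chain by the diamonds whose cliques
    form the right summand. With m = k-3, cliques have k-1 vertices. *)
Definition spindle_vertex : finType := ('I_n.+3 + 'I_n.+2 * 'I_m.+2)%type.

Definition spindle_adj : rel spindle_vertex := fun x y =>
  match x, y with
  | inl i, inl j => (i == 0 :> nat) && (j == n.+2 :> nat) ||
                    (j == 0 :> nat) && (i == n.+2 :> nat)
  | inl i, inr (j, _) => (i == j :> nat) || (i == j.+1 :> nat)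
  | inr (j, _), inl i => (i == j :> nat) || (i == j.+1 :> nat)
  | inr (i, c), inr (j, d) => (i == j) && (c != d)
  end.

Lemma spindle_adj_sym : symmetric spindle_adj.
Proof.
by move=> [i|[i c]] [j|[j d]] //=; [rewrite orbC|rewrite (eq_sym i) (eq_sym c)].
Qed.

Lemma spindle_adj_irr : irreflexive spindle_adj.
Proof. by move=> [i|[i c]] /=; [lia|rewrite !eqxx]. Qed.

Definition spindle : sgraph := SGraph spindle_adj_sym spindle_adj_irr.

Definition hub (i : 'I_n.+3) : spindle := inl i.
Definition blade (i : 'I_n.+2) (c : 'I_m.+2) : spindle := inr (i, c).
(** The vertex of each diamond that may be identified with a vertex of T. *)
Definition tip (i : 'I_n.+2) : spindle := blade i ord0.

Lemma tip_inj : injective tip.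
Proof. by move=> i j []. Qed.

Lemma tip_independent i j : ~~ adj (tip i) (tip j).
Proof. by rewrite /= andbF. Qed.

Lemma adj_end_hubs : adj (hub ord0) (hub ord_max).
Proof. by rewrite /= !eqxx. Qed.

(** Otherwise the two hubs and the k-1 clique vertices between them would show
    k+1 distinct colours. *)
Lemma diamond_forces_equal (f : spindle -> nat) (i : 'I_n.+2) :
  (forall x, f x < m.+3) -> (forall x y, adj x y -> f x != f y) ->
  f (hub (widen_ord (leqnSn _) i)) = f (hub (lift ord0 i)).
Proof.
move=> fk fP; apply/eqP; apply/negPn/negP => nf.
pose l := [seq f (blade i c) | c <- enum 'I_m.+2].
pose l2 := [:: f (hub (widen_ord (leqnSn _) i)), f (hub (lift ord0 i)) & l].
have lN (j : 'I_n.+3) : (j == i :> nat) || (j == i.+1 :> nat) -> f (hub j) \notin l.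
  by move=> ji; apply/mapP => -[c _ /eqP]; apply/negP/fP.
have Ul : uniq l2.
  rewrite /= inE negb_or nf !lN /= ?eqxx ?orbT //.
  rewrite map_inj_in_uniq ?enum_uniq // => c d _ _ fcd.
  apply/eqP; apply/negPn/negP => ncd.
  by have := fP (blade i c) (blade i d); rewrite fcd /= !eqxx => /(_ ncd).
have /(uniq_leq_size Ul) : {subset l2 <= iota 0 m.+3}.
  move=> a; rewrite mem_iota /= add0n !inE.
  by case/or3P => [/eqP->|/eqP->|/mapP[c _ ->]]; exact: fk.
by rewrite /= size_map size_enum_ord size_iota ltnn.
Qed.

Lemma spindle_not_colorable : ~~ colorable spindle m.+3.
Proof.
apply/colorableP => -[f [fk fP]].
suff eqf i (ilt : i < n.+3) : f (hub (Ordinal ilt)) = f (hub ord0).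
  have := fP _ _ adj_end_hubs; rewrite -(eqf n.+2 (ltnSn _)).
  by rewrite (_ : Ordinal _ = ord_max) ?eqxx //; apply: val_inj.
elim: i ilt => [|i IH] ilt; first by congr (f (hub _)); apply: val_inj.
rewrite -(IH (ltnW ilt)).
have -> : Ordinal (ltnW ilt) = widen_ord (leqnSn _) (Ordinal (ilt : i < n.+2)) by apply: val_inj.
rewrite (diamond_forces_equal _ fk fP); congr (f (hub _)); exact: val_inj.
Qed.

(** The hubs have colour 1 up to diamond p and 2 after it. A diamond other than p
    sees one of these, and its blade 1 takes the other; in diamond p, whose tip is
    to be deleted, blade 1 takes the colour 0 reserved for tips. *)
Definition split_coloring (p : 'I_n.+2) (x : spindle) : nat :=
  match x with
  | inl i => if i <= p then 1 else 2
  | inr (i, c) => if c == 0 :> nat then 0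
                  else if c == 1 :> nat then
                    if i < p then 2 else if i == p then 0 else 1
                  else c.+1
  end.

Lemma split_coloring_lt p x : split_coloring p x < m.+3.
Proof. by case: x => [i|[i c]] /=; do ?case: ifP => ?; rewrite ?ltnS ?leq_ord. Qed.

Lemma split_coloring_proper p x y : adj x y -> x != tip p -> y != tip p ->
  split_coloring p x != split_coloring p y.
Proof.
have := ltn_ord p.
case: x => [i|[i c]]; case: y => [j|[j d]] //=; rewrite -?val_eqE /=.
- by do ?case: ifP => ?; lia.
- by do ?case: ifP => ?; lia.
- by do ?case: ifP => ?; lia.
move=> pn /andP[/eqP/val_inj <-] cd.
rewrite -![inr _ != _]/(_ != _).
have tE (e : 'I_m.+2) : (inr (i, e) != tip p) = ~~ ((i == p :> nat) && (e == 0 :> nat)) by [].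
by rewrite !tE; do ?case: ifP => ?; lia.
Qed.

(** Colouring all hubs alike fails only on the edge between the two end hubs. *)
Definition flat_coloring (x : spindle) : nat :=
  match x with inl _ => 1 | inr (_, c) => if c == 0 :> nat then 0 else c.+1 end.

Lemma flat_coloring_lt x : flat_coloring x < m.+3.
Proof. by case: x => [i|[i c]] //=; case: ifP => ?; rewrite ?ltnS ?leq_ord. Qed.

Lemma flat_coloring_conflict x y : adj x y -> flat_coloring x = flat_coloring y ->
  [\/ x = hub ord0 /\ y = hub ord_max | x = hub ord_max /\ y = hub ord0].
Proof.
case: x => [i|[i c]]; case: y => [j|[j d]] //=.
- by case/orP => /andP[/eqP i0 /eqP j0] _; [left|right]; split; congr inl; apply: val_inj.
- by case: ifP => ?; lia.
- by case: ifP => ?; lia.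
by move=> /andP[_]; rewrite -val_eqE /=; do ?case: ifP => ?; lia.
Qed.

Lemma end_hubs_no_common_neighbour x :
  adj (hub ord0) x -> adj (hub ord_max) x -> False.
Proof. by case: x => [i|[i c]] /=; lia. Qed.

(** A hub with an adjacent diamond: a clique on exactly k vertices. *)
Definition blade_clique : {set spindle} :=
  hub ord0 |: [set blade ord0 c | c in 'I_m.+2].

Lemma blade_cliqueP : clique blade_clique.
Proof.
apply/cliqueP => x y.
rewrite !inE => /orP[/eqP->|/imsetP[c _ ->]] /orP[/eqP->|/imsetP[d _ ->]] //.
Qed.

Lemma card_blade_clique : #|blade_clique| = m.+3.
Proof.
rewrite cardsU1 card_imset => [|c d [] //]; rewrite card_ord.
by case: imsetP => // -[].
Qed.

End Spindle.

(** * The realizing graph *)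

Section Construction.

Variables (m : nat) (U : finType) (H : {set {set U}}) (M : nat).

(** One gadget per subset of U and copy number; [base_adj] keeps only the edges of
    gadgets whose subset lies in H. *)
Definition label : finType := ({set U} * 'I_M)%type.

Implicit Types g h : label.

Definition gadget : sgraph := spindle m #|U|.

(** The gadget has #|U|.+2 diamonds, so that every element of U has its own and there
    are always at least two. *)
Definition pos (u : U) : 'I_#|U|.+2 := widen_ord (leqW (leqnSn _)) (enum_rank u).

Definition terminal (u : U) : gadget := tip m (pos u).

Lemma pos_inj : injective pos.
Proof. by move=> u v [] /ord_inj /enum_rank_inj. Qed.

Lemma terminal_inj : injective terminal.
Proof. by move=> u v /tip_inj /pos_inj. Qed.

Definition base : finType := (U + label * gadget)%type.

(** Where the gadget labelled g puts its vertex q. Only terminals of elements of g.1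
    are shared between gadgets; those of other elements are private vertices. *)
Definition place (g : label) (q : gadget) : base :=
  if [pick u in g.1 | q == terminal u] is Some u then inl u else inr (g, q).

Variant place_spec (g : label) (q : gadget) : base -> Type :=
| PlaceTerminal u of u \in g.1 & q = terminal u : place_spec g q (inl u)
| PlacePrivate of (forall u, u \in g.1 -> q != terminal u) :
    place_spec g q (inr (g, q)).

Lemma placeP g q : place_spec g q (place g q).
Proof.
rewrite /place; case: pickP => [u /andP[ug /eqP qu]|h]; first exact: PlaceTerminal.
by apply: PlacePrivate => u ug; have := h u; rewrite ug /= => ->.
Qed.

Lemma place_terminal g u : u \in g.1 -> place g (terminal u) = inl u.
Proof. by move=> ug; case: placeP => [v _ /terminal_inj ->//|/(_ u ug)/eqP]. Qed.

Lemma place_hub g i : place g (hub m i) = inr (g, hub m i).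
Proof. by case: placeP. Qed.

Lemma place_inl g q u : place g q = inl u -> q = terminal u /\ u \in g.1.
Proof. by case: placeP => // v vg -> [<-]. Qed.

Lemma place_inr g q h r : place g q = inr (h, r) -> g = h /\ q = r.
Proof. by case: placeP => // _ [-> ->]. Qed.

Lemma place_inj g : injective (place g).
Proof.
move=> q r; case: (placeP g r) => [u _ ->|_]; first by case/place_inl.
by case/place_inr.
Qed.

Definition base_adj : rel base := fun x y =>
  [exists g : label, exists q : gadget, exists r : gadget,
     [&& g.1 \in H, adj q r, x == place g q & y == place g r]].

Lemma base_adjP x y :
  reflect (exists g q r, [/\ g.1 \in H, adj q r, x = place g q & y = place g r])
          (base_adj x y).
Proof.
apply: (iffP existsP) => [[g /existsP[q /existsP[r /and4P[? ? /eqP ? /eqP ?]]]]|].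
  by exists g, q, r.
move=> [g [q [r [gH qr -> ->]]]]; exists g; apply/existsP; exists q.
by apply/existsP; exists r; rewrite gH qr !eqxx.
Qed.

Lemma base_adj_sym : symmetric base_adj.
Proof.
suff imp x y : base_adj x y -> base_adj y x by move=> x y; apply/idP/idP; exact: imp.
move=> /base_adjP[g [q [r [gH qr xq yr]]]].
by apply/base_adjP; exists g, r, q; rewrite adj_sym.
Qed.

Lemma base_adj_irr : irreflexive base_adj.
Proof.
move=> x; apply/base_adjP => -[g [q [r [_ qr -> /place_inj qE]]]].
by rewrite qE adj_irr in qr.
Qed.

Lemma base_adj_terminals u v : ~~ base_adj (inl u) (inl v).
Proof.
apply/base_adjP => -[g [q [r [_ qr /esym/place_inl[qE _] /esym/place_inl[rE _]]]]].
by move: qr; rewrite qE rE; apply/negP; exact: tip_independent.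
Qed.

Lemma base_adj_private g q (y : base) : base_adj (inr (g, q)) y ->
  exists2 r, adj q r & y = place g r.
Proof.
move=> /base_adjP[h [q' [r [_ qr /esym/place_inr[<- <-] ->]]]].
by exists r.
Qed.

(** The label makes the connectors used by one gadget private to it. *)
Definition connector : finType :=
  {w : label * base * base | w.1.2 != w.2}.

Definition joins (w : connector) (x : base) : bool :=
  (x == (val w).1.2) || (x == (val w).2).

Definition real_adj : rel (base + connector)%type := fun x y =>
  match x, y with
  | inl a, inl b => base_adj a b
  | inl a, inr w => joins w a
  | inr w, inl a => joins w a
  | inr _, inr _ => false
  end.

Lemma real_adj_sym : symmetric real_adj.
Proof. by move=> [a|w] [b|v] //=; exact: base_adj_sym. Qed.

Lemma real_adj_irr : irreflexive real_adj.
Proof. by move=> [a|w] //=; exact: base_adj_irr. Qed.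

Definition realization : sgraph := SGraph real_adj_sym real_adj_irr.

Notation G := realization.

Definition of_base (x : base) : G := inl x.
Definition iota_real (u : U) : G := of_base (inl u).

(** * Colourings and cliques of the realizing graph *)

Definition third (a b : nat) : nat :=
  if (a != 0) && (b != 0) then 0 else if (a != 1) && (b != 1) then 1 else 2.

Lemma third_neq a b : (third a b != a) && (third a b != b).
Proof. by rewrite /third; do ?case: ifP; lia. Qed.

Lemma third_leq a b : third a b <= 2.
Proof. by rewrite /third; do ?case: ifP. Qed.

(** Of any three colours, one differs from those of the two neighbours of a
    connector. *)
Lemma colorable_from_base (X : {set G}) (k : nat) (f : base -> nat) :
  2 < k ->
  (forall x, of_base x \in X -> f x < k) ->
  (forall x y, of_base x \in X -> of_base y \in X -> base_adj x y -> f x != f y) ->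
  colorable (induced_sgraph X) k.
Proof.
move=> k2 fk fP; apply/induced_colorableP.
exists (fun x : G => match x with
  | inl a => f a
  | inr w => third (f (val w).1.2) (f (val w).2) end); split.
  by move=> [a|w] wX; [exact: fk|exact: leq_ltn_trans (third_leq _ _) k2].
move=> [a|w] [b|v] aX bX //=; first exact: fP.
  have /andP[? ?] := third_neq (f (val v).1.2) (f (val v).2).
  by case/orP => /eqP->; rewrite eq_sym.
have /andP[? ?] := third_neq (f (val w).1.2) (f (val w).2).
by case/orP => /eqP->.
Qed.

(** Each gadget splits its chain of hubs at a terminal outside X; the gadgets agree
    where they meet because split colourings give 0 to every terminal. *)
Lemma realization_colorable_edge_free (X : {set G}) :
  (forall e, e \in H -> ~~ (iota_real @: e \subset X :&: iota_real @: cover H)) ->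
  colorable (induced_sgraph X) m.+3.
Proof.
move=> Xfree.
pose miss (g : label) := [pick u in g.1 | iota_real u \notin X].
have missP (g : label) : g.1 \in H ->
    exists u, [/\ miss g = Some u, u \in g.1 & iota_real u \notin X].
  move=> gH; rewrite /miss; case: pickP => [u /andP[ug uX]|h]; first by exists u.
  case/negP: (Xfree _ gH); apply/subsetP => _ /imsetP[u ug ->].
  have uX : iota_real u \in X by apply: contraFT (h u) => uX; rewrite ug.
  by rewrite in_setI uX imset_f //; apply/bigcupP; exists g.1.
pose p g := if miss g is Some u then pos u else ord0.
pose f (x : base) := match x with
  | inl _ => 0
  | inr (g, q) => split_coloring (p g) q end.
have fE (g : label) q : f (place g q) = split_coloring (p g) q.
  by case: placeP => [u _ ->|_] //=.
apply: (@colorable_from_base _ _ f) => // [[u|[g q]] _ //|x y xX yX].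
  exact: split_coloring_lt.
move=> /base_adjP[g [q [r [gH qr xE yE]]]]; subst x y; rewrite !fE.
have [u [mu ug uX]] := missP g gH.
have nterm s : of_base (place g s) \in X -> s != tip m (p g).
  apply: contraTneq => ->; rewrite /p mu.
  by rewrite -/(terminal u) place_terminal.
by apply: split_coloring_proper => //; exact: nterm.
Qed.

(** A clique with a connector has at most 3 vertices. In any other clique the flat
    colouring is injective, unless the clique contains both end hubs of a gadget and
    nothing else, as these have no common neighbour. *)
Lemma realization_clique (A : {set G}) : clique A -> #|A| <= m.+3.
Proof.
move=> /cliqueP cA.
have [/existsP[w wA]|/existsPn nw] := boolP [exists w : connector, inr w \in A].
  apply: (@leq_trans 3) => //.
  apply: (@leq_trans #|[set (inr w : G); inl (val w).1.2; inl (val w).2]|).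
    apply: subset_leq_card; apply/subsetP => x xA.
    have [->|nxw] := eqVneq x (inr w); first by rewrite !inE eqxx.
    have := cA _ _ xA wA nxw; case: x xA {nxw} => // a _ /orP[]/eqP->;
      by rewrite !inE eqxx ?orbT.
  by rewrite -setUA cardsU1 cards2; do ?case: (_ \notin _); do ?case: (_ != _).
pose c (x : base) := match x with
  | inl _ => 0 | inr (_, q) => flat_coloring q end.
have cE g q : c (place g q) = flat_coloring q.
  by case: placeP => [u _ ->|_].
pose c' (x : G) : 'I_m.+3 := if x is inl x' then inord (c x') else ord0.
have baseA x : x \in A -> exists2 x', x = of_base x' & c' x = c x' :> nat.
  case: x => [x|w] xA; last by have := nw w; rewrite xA.
  exists x => //=; rewrite inordK //.
  by case: x {xA} => [//|[g q]] /=; exact: flat_coloring_lt.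
have [ci|] := boolP [forall x in A, forall y in A, (c' x == c' y) ==> (x == y)].
  rewrite -[m.+3]card_ord -(card_in_imset (f := c') (D := A)) ?max_card // => x y xA yA cxy.
  by have /forallP/(_ x) := ci; rewrite xA => /forallP/(_ y); rewrite yA cxy eqxx => /eqP.
case/forall_inPn => x xA /forall_inPn[y yA]; rewrite negb_imply => /andP[/eqP cxy nxy].
apply: (@leq_trans 2) => //; apply: (@leq_trans #|[set x; y]|); last by rewrite cards2; case: (_ != _).
apply: subset_leq_card; apply/subsetP => z zA.
rewrite !inE; apply/norP => -[nzx nzy].
have [x' xE cx] := baseA x xA; have [y' yE cy] := baseA y yA; have [z' zE _] := baseA z zA.
have := cA x z xA zA; rewrite eq_sym nzx => /(_ isT).
have := cA y z yA zA; rewrite eq_sym nzy => /(_ isT).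
have := cA x y xA yA nxy.
have {cxy} : c x' = c y' by rewrite -cx -cy cxy.
rewrite xE yE zE => cxy /base_adjP[g [q [r [_ qr x'E y'E]]]].
move: cxy; rewrite x'E y'E !cE.
move=> /(flat_coloring_conflict qr)[][-> ->]; rewrite !place_hub.
  move=> /base_adj_private[s ms ->] /base_adj_private[t zt] /place_inj st.
  by apply: (end_hubs_no_common_neighbour zt); rewrite -st.
move=> /base_adj_private[s ms ->] /base_adj_private[t zt] /place_inj st.
by apply: (end_hubs_no_common_neighbour ms); rewrite st.
Qed.


(** * Chromatic number, size and connectivity *)

Lemma gadget_not_colorable g (X : {set G}) :
  g.1 \in H -> (forall q, of_base (place g q) \in X) ->
  ~~ colorable (induced_sgraph X) m.+3.
Proof.
move=> gH gX; apply: contra (spindle_not_colorable m #|U|) => /induced_colorableP[f [fk fP]].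
apply/colorableP; exists (fun q => f (of_base (place g q))); split=> [q|q r qr].
  exact: fk.
by apply: fP => //; apply/base_adjP; exists g, q, r.
Qed.

Lemma terminals_independent : independent (iota_real @: cover H).
Proof.
apply/independentP => _ _ /imsetP[u _ ->] /imsetP[v _ ->].
exact: base_adj_terminals.
Qed.

Lemma realization_omega g : g.1 \in H -> omega G = m.+3.
Proof.
move=> gH; apply/eqP; rewrite eqn_leq (leq_omega realization_clique) /=.
pose f q := of_base (place g q).
have f_inj : injective f by move=> q r [] /place_inj.
rewrite -(card_blade_clique m #|U|) -(card_imset _ f_inj).
apply: clique_leq_omega; apply/cliqueP => _ _ /imsetP[q qK ->] /imsetP[r rK ->] nqr.
have /cliqueP/(_ q r qK rK) := blade_cliqueP m #|U|.
rewrite -(inj_eq f_inj) => /(_ nqr) qr.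
by apply/base_adjP; exists g, q, r.
Qed.

Lemma realization_chi g : set0 \notin H -> g.1 \in H -> chi G = m.+4.
Proof.
move=> H0 gH; apply/eqP; rewrite eqn_leq; apply/andP; split.
  rewrite chi_leq; apply: colorable_independent_extension terminals_independent _.
  apply: realization_colorable_edge_free => e eH.
  have /set0Pn[u ue] : e != set0 by apply: contraNneq H0 => <-.
  apply/subsetPn; exists (iota_real u); first exact: imset_f.
  by rewrite !in_setI in_setC andNb.
rewrite ltnNge chi_leq; apply/colorableP => -[f [fk fP]].
have /negP[] := @gadget_not_colorable g setT gH (fun q => in_setT _).
by apply/induced_colorableP; exists f; split=> [x _|x y _ _]; [exact: fk|exact: fP].
Qed.

(** The default value only arises for x = y, where there is no connector. *)
Definition connect_via g (x y : base) : G :=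
  if insub (g, x, y) is Some w then inr w else of_base x.

Lemma connect_viaP g x y : x != y ->
  exists2 w : connector, connect_via g x y = inr w & val w = (g, x, y).
Proof.
move=> xy; rewrite /connect_via; case: insubP => [w _ wE|/negP//]; by exists w.
Qed.

(** An edge is obtained from some connector w, as one of the two edges at w or as
    the pair that w joins. *)
Lemma realization_edges g : #|edges G| <= m.+3 * #|G|.
Proof.
pose E1 := [set [set of_base (val w).1.2; of_base (val w).2] | w in connector].
pose E2 := [set [set (inr w : G); of_base (val w).1.2] | w in connector].
pose E3 := [set [set (inr w : G); of_base (val w).2] | w in connector].
have EE : edges G \subset E1 :|: E2 :|: E3.
  apply/subsetP => _ /imsetP[[x y] + ->]; rewrite inE /=.
  have sub w a : joins w a -> [set (inr w : G); of_base a] \in E1 :|: E2 :|: E3.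
    by case/orP => /eqP->; rewrite !in_setU; apply/orP; [left; apply/orP|]; right;
       apply/imsetP; exists w.
  case: x => [a|w]; case: y => [b|v] //= h; last 2 first.
  - by rewrite setUC; exact: sub.
  - exact: sub.
  have nab : a != b by apply: contraTneq h => ->; rewrite base_adj_irr.
  have [w _ wE] := connect_viaP g nab.
  by rewrite !in_setU; apply/orP; left; apply/orP; left; apply/imsetP; exists w; rewrite // wE.
apply: leq_trans (subset_leq_card EE) _.
have c1 : #|E1| <= #|connector| by exact: leq_imset_card.
have c2 : #|E2| <= #|connector| by exact: leq_imset_card.
have c3 : #|E3| <= #|connector| by exact: leq_imset_card.
apply: leq_trans (leq_card_setU _ _) _; apply: leq_trans (leq_add (leq_card_setU _ _) (leqnn _)) _.
apply: (@leq_trans (3 * #|connector|)); last by rewrite leq_mul // [#|G|]card_sum leq_addl.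
by rewrite !mulSn mul0n addn0 addnA !leq_add.
Qed.

(** Two base vertices are joined by the connectors of both ordered pairs, and one
    vertex can remove only one of these two; a connector keeps at least one of its
    two neighbours. *)
Lemma realization_two_connected g : k_connected 2 G.
Proof.
pose a0 : base := inr (g, hub m ord0); pose b0 : base := inr (g, hub m ord_max).
have nab0 : a0 != b0 by apply/eqP => -[].
apply: two_connectedP.
  have [w _ _] := connect_viaP g nab0.
  rewrite [#|G|]card_sum -addn1; apply: leq_add; last by apply/card_gt0P; exists w.
  have <- : #|[set a0; b0]| = 2 by rewrite cards2 nab0.
  exact: max_card.
move=> X Xle1; pose R : rel G := fun a b => [&& a \notin X, b \notin X & adj a b].
have Rsym : connect_sym R.
  by apply: sym_connect_sym => a b; rewrite /R adj_sym andbA (andbC (a \notin X)) -andbA.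
have step x y : x \notin X -> y \notin X -> adj x y -> connect R x y.
  by move=> xX yX xy; apply: connect1; rewrite /R xX yX.
have avoid x y : x != y -> (x \notin X) || (y \notin X).
  by rewrite -negb_and; apply: contra => /andP[xX yX]; apply/eqP; exact: Xle1.
have base_conn a b : of_base a \notin X -> of_base b \notin X ->
    connect R (of_base a) (of_base b).
  move=> aX bX; have [->|nab] := eqVneq a b; first exact: connect0.
  have [w _ wE] := connect_viaP g nab.
  have [v _ vE] := connect_viaP g (negbT (etrans (eq_sym b a) (negbTE nab))).
  have nwv : inr w != inr v :> G.
    by apply: contraNneq nab => -[] wv; move: vE; rewrite -wv wE => -[->].
  have [ja ja'] : joins w a /\ joins v a by rewrite /joins wE vE /= !eqxx orbT.
  have [jb jb'] : joins w b /\ joins v b by rewrite /joins wE vE /= !eqxx orbT.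
  by case/orP: (avoid _ _ nwv) => nX; apply: connect_trans (step _ _ aX nX _) (step _ _ nX bX _).
have to_base x : x \notin X -> exists2 a, of_base a \notin X & connect R x (of_base a).
  case: x => [a|w] xX; first by exists a => //; exact: connect0.
  have : of_base (val w).1.2 != of_base (val w).2.
    by apply: contraNneq (valP w) => -[->].
  case/avoid/orP => nX; [exists (val w).1.2 => //|exists (val w).2 => //];
    by apply: step => //=; rewrite /joins eqxx ?orbT.
move=> x y; rewrite !in_setC -/R => /to_base[a aX xa] /to_base[b bX yb].
apply: connect_trans xa (connect_trans (base_conn _ _ aX bX) _).
by rewrite Rsym.
Qed.

(** * Odd cycles spanning the gadgets *)

(** Vertices of s preceded by the connectors that lead to them along the walk that
    starts at x. *)
Fixpoint weave g (x : base) (s : seq base) : seq G :=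
  if s is y :: s' then [:: connect_via g x y, of_base y & weave g y s'] else [::].

Lemma size_weave g x s : size (weave g x s) = (size s).*2.
Proof. by elim: s x => //= y s IH x; rewrite IH. Qed.

Lemma last_weave g x s : last (of_base x) (weave g x s) = of_base (last x s).
Proof. by elim: s x => //= y s IH x. Qed.

Lemma path_weave g x s : uniq (x :: s) -> path (@adj G) (of_base x) (weave g x s).
Proof.
elim: s x => //= y s IH x; rewrite inE negb_or => /and3P[/andP[nxy _] ys Us].
have [w -> wE] := connect_viaP g nxy.
by rewrite /= /joins wE /= !eqxx orbT IH //= ys.
Qed.

Lemma mem_weave_base g x s a : uniq (x :: s) ->
  (of_base a \in weave g x s) = (a \in s).
Proof.
elim: s x => //= y s IH x; rewrite inE negb_or => /and3P[/andP[nxy _] ys Us].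
have [w -> wE] := connect_viaP g nxy.
by rewrite !in_cons IH //= ys.
Qed.

Lemma mem_weave_connector g x s (w : connector) : uniq (x :: s) ->
  inr w \in weave g x s -> (val w).1.1 = g /\ (val w).1.2 \in x :: s.
Proof.
elim: s x => //= y s IH x; rewrite inE negb_or => /and3P[/andP[nxy _] ys Us].
have [v -> vE] := connect_viaP g nxy.
rewrite !inE => /or3P[/eqP[->]|//|].
  by rewrite vE eqxx.
by move=> /IH[|-> h]; [rewrite /= ys|split=> //; rewrite -in_cons h orbT].
Qed.

Lemma uniq_weave g x s : uniq (x :: s) -> uniq (of_base x :: weave g x s).
Proof.
move=> Us; rewrite cons_uniq mem_weave_base //; have /andP[-> _] := Us.
elim: s x Us => //= y s IH x; rewrite inE negb_or => /and3P[/andP[nxy xs] ys Us].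
rewrite (mem_weave_base _ _ (s := s)) /= ?ys // IH /= ?ys // !andbT.
have [w -> wE] := connect_viaP g nxy.
rewrite inE /=; apply/negP => /mem_weave_connector[]; rewrite /= ?ys //.
by rewrite wE /= inE (negPf nxy) (negPf xs).
Qed.

(** The order puts the end hubs first and last, as their edge closes the tour without
    a connector and so makes its length odd. *)
Definition gadget_stops g : seq base :=
  [seq place g q | q <- rcons [seq q <- enum gadget | q \notin [:: hub m ord0; hub m ord_max]]
                            (hub m ord_max)].

Lemma uniq_gadget_stops g : uniq (place g (hub m ord0) :: gadget_stops g).
Proof.
rewrite -[_ :: _]/(map (place g) (_ :: _)) map_inj_uniq; last exact: place_inj.
by rewrite /= mem_rcons rcons_uniq !inE !mem_filter !inE !eqxx ?orbT /= filter_uniq ?enum_uniq.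
Qed.

Lemma mem_gadget_stops g q :
  place g q \in place g (hub m ord0) :: gadget_stops g.
Proof.
rewrite -[_ :: _]/(map (place g) (_ :: _)) mem_map; last exact: place_inj.
by rewrite inE mem_rcons inE mem_filter mem_enum !inE; do 2!case: (_ == _).
Qed.

Definition tour g : seq G :=
  of_base (place g (hub m ord0)) :: weave g (place g (hub m ord0)) (gadget_stops g).

Lemma mem_tour_place g q : of_base (place g q) \in tour g.
Proof.
have := mem_gadget_stops g q; rewrite inE => /predU1P[->|qs]; first exact: mem_head.
by rewrite inE mem_weave_base ?qs ?orbT // uniq_gadget_stops.
Qed.

(** The gadget to which a vertex is private, if any. *)
Definition home (x : G) : option label :=
  match x with
  | inl (inl _) => None
  | inl (inr (g, _)) => Some g
  | inr w => Some (val w).1.1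
  end.

Lemma tourP g x : x \in tour g ->
  home x = Some g \/ exists2 u, u \in g.1 & x = iota_real u.
Proof.
have place_home q : home (of_base (place g q)) = Some g \/
    exists2 u, u \in g.1 & of_base (place g q) = iota_real u.
  by case: placeP => [u ug _|_]; [right; exists u|left].
rewrite inE => /predU1P[->|]; first exact: place_home.
case: x => [a|w].
  by rewrite mem_weave_base ?uniq_gadget_stops // => /mapP[q _ ->]; exact: place_home.
by move=> /(mem_weave_connector (uniq_gadget_stops g))[/= -> _]; left.
Qed.

Lemma cycle_tour g : g.1 \in H -> ucycle (@adj G) (tour g).
Proof.
move=> gH; rewrite /ucycle uniq_weave ?uniq_gadget_stops // andbT.
rewrite /cycle /tour rcons_path path_weave ?uniq_gadget_stops //= last_weave.
rewrite /gadget_stops map_rcons last_rcons real_adj_sym.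
by apply/base_adjP; exists g, (hub m ord0), (hub m ord_max); rewrite gH adj_end_hubs.
Qed.

Lemma size_tour g : exists l, size (tour g) = l.*2.+3.
Proof. by rewrite /= size_weave size_map size_rcons doubleS; eexists. Qed.

Lemma tour_bad g : g.1 \in H -> cycle_edges (tour g) \in bad_cycles m.+3 G.
Proof.
move=> gH; have [l sl] := size_tour g; have gU := cycle_tour gH.
apply/mem_bad_cyclesP; split.
- by exists (tour g); split=> //; rewrite sl.
- rewrite card_cycle_edges ?sl //; first by rewrite /= odd_double.
  by have /andP[] := gU.
rewrite cover_cycle_edges; apply: (gadget_not_colorable gH) => q.
by rewrite inE mem_tour_place.
Qed.

Lemma tour_trace g : g.1 \in H ->
  trace (iota_real @: cover H) (cycle_edges (tour g)) = iota_real @: g.1.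
Proof.
move=> gH; apply/setP => x; rewrite inE cover_cycle_edges inE.
apply/andP/imsetP => [[/tourP[xg|//] /imsetP[u _ xE]]|[u ug ->]].
  by rewrite xE in xg.
split; last by apply: imset_f; apply/bigcupP; exists g.1.
by rewrite /iota_real -(place_terminal ug) mem_tour_place.
Qed.

Lemma tour_home g x : g.1 \in H ->
  x \in cover (cycle_edges (tour g)) :\: iota_real @: cover H -> home x = Some g.
Proof.
move=> gH; rewrite cover_cycle_edges inE => /andP[xT]; rewrite inE => /tourP[//|[u ug xE]].
by case/imsetP: xT; exists u => //; apply/bigcupP; exists g.1.
Qed.

Lemma tour_inj g h : cycle_edges (tour g) = cycle_edges (tour h) -> g = h.
Proof.
move=> /(congr1 (fun C => cover C)); rewrite !cover_cycle_edges.
move=> /setP/(_ (of_base (place g (hub m ord0)))); rewrite !in_set mem_tour_place.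
by move=> /esym/tourP; rewrite place_hub => -[[]//|[u _ []]].
Qed.

End Construction.

Theorem theorem3p2 (R : realType) (k : nat) (hk : 3 <= k) (U : finType)
    (H : {set {set U}}) (hH : clutter H) (hH0 : H != set0)
    (M : nat) (hM : 1 <= M) :
  exists (G : sgraph) (iota : U -> G),
    let V := cover H in
    let T := iota @: V in
    [/\ {in V &, injective iota} /\ independent T,
        [/\ k_connected 2 G, chi G = k.+1, omega G = k
          & #|edges G| <= k * #|G|],
        forall X : {set G},
          (forall e, e \in H -> ~~ (iota @: e \subset X :&: T)) ->
          colorable (induced_sgraph X) k,
        exists C : {set U} -> 'I_M -> {set {set G}},
          [/\ forall e, e \in H -> injective (C e),
              forall e j, e \in H ->
                C e j \in bad_cycles k G /\ trace T (C e j) = iota @: e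
            & forall e f i j, e \in H -> f \in H -> (e, i) != (f, j) ->
                [disjoint cover (C e i) :\: T & cover (C f j) :\: T]]
      & [/\ [set iota @: e | e : {set U} in H]
              = minimal_members [set trace T C | C in bad_cycles k G],
            nustar_k R k G = nustar R V H,
            tau V H <= M -> tau_k k G = tau V H,
            forall b, 1 <= b -> b <= M -> nu_k b k G = nuZ b V H
          & forall B, 1 <= B -> maxn (tau V H) B <= M ->
              [/\ tau_k k G = tau V H, nustar_k R k G = nustar R V H
                & forall c, 1 <= c <= B -> nu_k c k G = nuZ c V H]]].
Proof.
case: k hk => [|[|[|m]]] // _.
have /set0Pn[e0 e0H] := hH0.
pose g0 : label U M := (e0, Ordinal hM).
have g0H : g0.1 \in H by [].
pose C (e : {set U}) (j : 'I_M) := cycle_edges (tour m H (e, j)).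
have iota_inj : {in cover H &, injective (@iota_real m U H M)} by move=> u v _ _ [].
have C_inj e : e \in H -> injective (C e) by move=> _ i j /tour_inj[].
have C_bad e j : e \in H -> C e j \in bad_cycles m.+3 (realization m H M).
  by move=> eH; exact: tour_bad.
have C_trace e j : e \in H ->
    trace (@iota_real m U H M @: cover H) (C e j) = @iota_real m U H M @: e.
  by move=> eH; exact: (@tour_trace _ _ _ _ (e, j)).
have C_disjoint e f i j : e \in H -> f \in H -> (e, i) != (f, j) ->
    [disjoint cover (C e i) :\: @iota_real m U H M @: cover H
            & cover (C f j) :\: @iota_real m U H M @: cover H].
  move=> eH fH; apply: contraR => /pred0Pn[x /andP[/= xe xf]].
  have [xei xfj] := (@tour_home _ _ _ _ (e, i) x eH xe, @tour_home _ _ _ _ (f, j) x fH xf).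
  by apply/eqP; move: xei; rewrite xfj => -[-> ->].
have colorable_free := @realization_colorable_edge_free m U H M.
have [H0 _] := hH.
have tauP := tau_k_realization hH iota_inj colorable_free C_bad C_trace C_disjoint.
have nustarP := nustar_k_realization hH hM iota_inj colorable_free C_bad C_trace C_disjoint.
have nuP := nu_k_realization hH iota_inj colorable_free C_bad C_trace C_inj C_disjoint.
exists (realization m H M), (@iota_real m U H M) => V T; split.
- by split; last exact: terminals_independent.
- split; [exact: realization_two_connected g0|exact: realization_chi H0 g0H|
          exact: realization_omega g0H|exact: realization_edges g0].
- exact: colorable_free.
- by exists C; split=> // e j eH; split; [exact: C_bad|exact: C_trace].
split=> //.
  exact: (minimal_traces hH hM iota_inj colorable_free C_bad C_trace).
move=> B B0; rewrite geq_max => /andP[tauM BM]; split=> // [|c /andP[c0 cB]].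
  exact: tauP.
by apply: nuP => //; exact: leq_trans cB BM.
Qed.
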